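(* Consider an RBM with observed variables $X\in\{-1,1\}^n$ as in the context. Fix $\delta>0$, $\epsilon>0$, $\zeta>0$. Suppose that for every observed variable $u$ we are given a set $n(u)$ which is a subset of the MRF neighborhood of $u$ and contains every $i$ for which there is $T\subseteq[n]$ with $u,i\in T$ and $|\hat f(T)|\ge\zeta$. Suppose that we are given $M$ i.i.d. samples of $X$ from the RBM and run the regression procedure of the context at each $u$. There is an absolute constant $C>0$ such that if \[M\ge C\,\gamma^2\ln(8\cdot n\cdot 2^D/\delta)/\epsilon^2\quad\text{and}\quad \zeta\le\frac{\sqrt\epsilon}{D^d\sqrt{1+e^{2\gamma}}},\] then with probability at least $1-\delta$, for all observed variables $u$, \[\mathbb{E}\big[(\mathbb{P}(X_u=1|X_{[n]\setminus\{u\}})-\sigma(\hat w_u\cdot z_u))^2\big]\le\epsilon,\] where the expectation is over $X$ drawn from the marginal of the RBM (with $\hat w_u$ fixed) and $z_u$ is the feature vector of $X$ at $u$.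
   Context: RBM: $\mathbb{P}(X=x,Y=y)\propto\exp(x^TJy+h^Tx+g^Ty)$ over observed $X\in\{-1,1\}^n$ and latent $Y\in\{-1,1\}^m$; $d=\max_j|\{i:J_{i,j}\ne0\}|$. The marginal of $X$ is $\propto\exp(f(x))$, $f(x)=\sum_j\rho(J_j\cdot x+g_j)+h^Tx$, $\rho(t)=\log(e^t+e^{-t})$, $J_j$ the $j$-th column; $f=\sum_{T\subseteq[n]}\hat f(T)\chi_T$, $\chi_T(x)=\prod_{i\in T}x_i$. MRF neighborhood of $u$: all $i\ne u$ with $\hat f(T)\ne0$ for some $T\ni u,i$. $D$: maximum size of an MRF neighborhood; $\gamma=\max_u\sum_{T\ni u}|\hat f(T)|$. $\sigma(t)=1/(1+e^{-t})$. Regression at $u$: the feature vector is $z_u=(\chi_T(X))_{T\subseteq n(u)}\in\{-1,1\}^{2^{|n(u)|}}$ and the label is $y=X_u$. Given samples $(z^{(k)},y^{(k)})_{k=1}^M$ computed from the $M$ samples of $X$, let $\hat w_u\in\arg\min\{\frac1M\sum_{k=1}^M\ln(1+e^{-y^{(k)}(w\cdot z^{(k)})}) : w\in\mathbb{R}^{2^{|n(u)|}},\ \|w\|_1\le2\gamma\}$. *)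

(* Defs.v *)
From HB Require Import structures.
From mathcomp Require Import all_boot all_order all_algebra.
From mathcomp Require Import boolp reals.
From mathcomp Require Import sequences exp.
Set Implicit Arguments. Unset Strict Implicit. Unset Printing Implicit Defensive.
Import Order.TTheory GRing.Theory Num.Theory.
Local Open Scope ring_scope.

Section RBM.
Variable R : realType.

Definition spin (b : bool) : R := if b then 1 else -1.

(* observed / latent configurations in {-1,1}^n, {-1,1}^m *)
Definition cfg (n : nat) := {ffun 'I_n -> bool}.

Definition rbm_weight (n m : nat) (J : 'M[R]_(n, m)) (h : 'I_n -> R)
    (g : 'I_m -> R) (x : cfg n) (y : cfg m) : R :=
  expR (\sum_(i < n) \sum_(j < m) spin (x i) * J i j * spin (y j)
        + \sum_(i < n) h i * spin (x i) + \sum_(j < m) g j * spin (y j)).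

Definition marg_weight n m J h g (x : cfg n) : R :=
  \sum_(y : cfg m) @rbm_weight n m J h g x y.
Definition marg_pmf n m J h g (x : cfg n) : R :=
  @marg_weight n m J h g x / \sum_(x' : cfg n) @marg_weight n m J h g x'.

Definition rho (t : R) : R := ln (expR t + expR (- t)).
Definition sigmoid (t : R) : R := 1 / (1 + expR (- t)).

Definition rbm_f n m (J : 'M[R]_(n, m)) (h : 'I_n -> R) (g : 'I_m -> R)
    (x : cfg n) : R :=
  \sum_(j < m) rho (\sum_(i < n) J i j * spin (x i) + g j)
  + \sum_(i < n) h i * spin (x i).

Definition chi n (T : {set 'I_n}) (x : cfg n) : R :=
  \prod_(i in T) spin (x i).

Definition fhat n m J h g (T : {set 'I_n}) : R :=
  (2%:R ^+ n)^-1 * \sum_(x : cfg n) @rbm_f n m J h g x * chi T x.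

Definition mrf_nbhd n m J h g (u : 'I_n) : {set 'I_n} :=
  [set i | (i != u) &&
     [exists T : {set 'I_n}, [&& u \in T, i \in T & @fhat n m J h g T != 0%R]]].

Definition Dmax n m J h g : nat := \max_(u < n) #|@mrf_nbhd n m J h g u|.

Definition dmax n m (J : 'M[R]_(n, m)) : nat :=
  \max_(j < m) #|[set i : 'I_n | J i j != 0%R]|.

Definition gammax n m J h g : R :=
  \big[Num.max/0]_(u < n) \sum_(T : {set 'I_n} | u \in T) `|@fhat n m J h g T|.

Definition feat_idx n (nu : {set 'I_n}) := {T : {set 'I_n} | T \subset nu}.

Definition wdot n (nu : {set 'I_n}) (w : feat_idx nu -> R) (x : cfg n) : R :=
  \sum_(T : feat_idx nu) w T * chi (val T) x.

Definition norm1 n (nu : {set 'I_n}) (w : feat_idx nu -> R) : R :=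
  \sum_(T : feat_idx nu) `|w T|.

Definition emp_loss n M (nu : {set 'I_n}) (u : 'I_n)
    (s : {ffun 'I_M -> cfg n}) (w : feat_idx nu -> R) : R :=
  M%:R^-1 * \sum_(k < M) ln (1 + expR (- (spin (s k u) * wdot w (s k)))).

Definition is_constrained_min n M (nu : {set 'I_n}) (u : 'I_n)
    (s : {ffun 'I_M -> cfg n}) (bound : R) (w : feat_idx nu -> R) : Prop :=
  norm1 w <= bound /\
  forall w' : feat_idx nu -> R, norm1 w' <= bound ->
    emp_loss u s w <= emp_loss u s w'.

Definition setc n (x : cfg n) (u : 'I_n) (b : bool) : cfg n :=
  [ffun i => if i == u then b else x i].

Definition cond_prob1 n m J h g (u : 'I_n) (x : cfg n) : R :=
  @marg_pmf n m J h g (setc x u true) /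
  (@marg_pmf n m J h g (setc x u true) + @marg_pmf n m J h g (setc x u false)).

Definition pred_error n m J h g (nu : {set 'I_n}) (u : 'I_n)
    (w : feat_idx nu -> R) : R :=
  \sum_(x : cfg n) @marg_pmf n m J h g x *
    (@cond_prob1 n m J h g u x - sigmoid (wdot w x)) ^+ 2.

Definition iid_prob n m J h g M (E : {ffun 'I_M -> cfg n} -> Prop) : R :=
  \sum_(s : {ffun 'I_M -> cfg n} | `[< E s >])
     \prod_(k < M) @marg_pmf n m J h g (s k).

End RBM.

(* Main.v *)
Require Import Defs.
From HB Require Import structures.
From mathcomp Require Import all_boot all_order all_algebra.
From mathcomp Require Import boolp reals topology normedtype.
From mathcomp Require Import sequences exp.
From mathcomp Require Import ring lra.
Import Order.TTheory GRing.Theory Num.Theory.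
Import numFieldNormedType.Exports.
Set Implicit Arguments.
Unset Strict Implicit.
Unset Printing Implicit Defensive.
Local Open Scope ring_scope.

(** The conditional law of [X_u] is logistic: its log-odds are linear in the
    features with coefficients [2 * fhat T], [u \in T].  Dropping the sets [T]
    with [T :\ u] not contained in [nbr u] leaves a vector [wstar] in the
    l1-ball of radius [2 gamma]; a dropped [T] has [|fhat T| < zeta], and at
    most [D ^ d] of them have [fhat T <> 0], so the log-odds move by at most
    [2 zeta D ^ d].  For the logistic loss the conditional excess risk dominates
    the squared error of the predicted probability, and is at most a quarter of
    the squared error of the log-odds.  It remains to bound the excess risk of
    the empirical minimizer over [wstar].  Symmetrization and the
    Ledoux-Talagrand contraction are applied directly to the exponential moment
    of the deviation, so that a Chernoff bound and a union bound over [u]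
    suffice, without a bounded-difference inequality. *)

(** * Exponential inequalities *)

Lemma leq_exp2_fact (k : nat) : (2 ^ k * k`! <= (k.*2)`!)%N.
Proof.
elim: k => // k IHk.
rewrite doubleS !factS expnS mulnACA mul2n doubleS leq_mul2l /=.
exact: leq_trans IHk (leq_pmull _ _).
Qed.

Lemma exp_coeff_pairE (R : realType) (x : R) (n : nat) :
  \sum_(0 <= i < n.*2) (exp_coeff x i + exp_coeff (- x) i) =
  \sum_(0 <= i < n) 2 * exp_coeff x i.*2.
Proof.
elim: n => [|n IHn]; first by rewrite !big_geq.
rewrite doubleS !big_nat_recr //= -addrA IHn; congr (_ + _).
have even_pow : (- x) ^+ n.*2 = x ^+ n.*2 by rewrite -mul2n !exprM sqrrN.
rewrite /exp_coeff /= !exprS even_pow !mulNr subrr addr0.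
by rewrite mulr_natl mulr2n.
Qed.

(** This is [cosh x <= exp (x^2 / 2)], compared coefficient by coefficient: odd terms cancel, and
    [(2k)!] is at least [2^k * k!]. *)
Lemma expRDexpRN_le (R : realType) (x : R) :
  expR x + expR (- x) <= 2 * expR (x ^+ 2 / 2).
Proof.
have cx := @is_cvg_series_exp_coeff R x.
have cNx := @is_cvg_series_exp_coeff R (- x).
rewrite [X in X + _]/expR [X in _ + X]/expR -limD //.
apply: limr_le; first exact: is_cvgD.
near=> n.
rewrite [leLHS](_ : _ = \sum_(0 <= i < n) (exp_coeff x i + exp_coeff (- x) i));
  last by rewrite big_split.
have pair_ge0 i : 0 <= exp_coeff x i + exp_coeff (- x) i.
  rewrite /exp_coeff /= -mulrDl divr_ge0 // (exprNn x) -signr_odd.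
  have [iodd|ieven] := boolP (odd i); first by rewrite expr1 mulN1r subrr.
  by rewrite expr0 mul1r addr_ge0 // real_exprn_even_ge0 // num_real.
(* The terms are nonnegative, so the truncation may be moved to [n.*2], which matches [n] terms on
   the right. *)
apply: (@le_trans _ _ (\sum_(0 <= i < n.*2) (exp_coeff x i + exp_coeff (- x) i))).
  rewrite -addnn (@big_cat_nat _ _ _ n 0 (n + n)) ?leq_addr //= lerDl.
  exact: sumr_ge0.
rewrite exp_coeff_pairE -mulr_sumr ler_pM2l //.
apply: (@le_trans _ _ (series (exp_coeff (x ^+ 2 / 2)) n)).
  apply: ler_sum => i _; rewrite /exp_coeff /= -mul2n exprM [(_ / 2) ^+ i]exprMn -mulrA.
  apply: ler_wpM2l; first by rewrite exprn_ge0 // sqr_ge0.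
  rewrite exprVn -invfM lef_pV2 ?posrE ?mulr_gt0 ?exprn_gt0 ?ltr0n ?fact_gt0 //.
  by rewrite -natrX -natrM ler_nat mul2n leq_exp2_fact.
apply: nondecreasing_cvgn_le; last exact: is_cvg_series_exp_coeff.
apply: nondecreasing_series => i _ _; rewrite /exp_coeff /=.
by rewrite divr_ge0 // exprn_ge0 // divr_ge0 // sqr_ge0.
Unshelve. all: by end_near. Qed.

(** Jensen's inequality for [expR], by averaging the tangent bound [exp y >= exp m * (1 + y - m)] at
    the mean [m]. *)
Lemma expR_sum_le (R : realType) (X : finType) (P y : X -> R) :
  (forall x, 0 <= P x) -> \sum_x P x = 1 ->
  expR (\sum_x P x * y x) <= \sum_x P x * expR (y x).
Proof.
move=> P0 P1; set m := \sum_x P x * y x.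
have -> : expR m = \sum_x P x * (expR m * (1 + (y x - m))).
  rewrite (eq_bigr (fun x => expR m * (1 - m) * P x + expR m * (P x * y x))).
    by rewrite big_split /= -!mulr_sumr P1 -/m; ring.
  by move=> x _; ring.
apply: ler_sum => x _; apply: ler_wpM2l => //.
rewrite -[X in _ <= expR X](subrKC m) expRD.
by rewrite ler_wpM2l ?expR_ge0 ?expR_ge1Dx.
Qed.

(** * Logistic loss and conditional risk *)

Definition logloss (R : realType) (t : R) : R := ln (1 + expR (- t)).

Lemma expRN_logloss (R : realType) (t : R) : expR (- logloss t) = sigmoid t.
Proof. by rewrite expRN lnK ?posrE ?addr_gt0 ?expR_gt0 // /sigmoid div1r. Qed.

Lemma loglossN (R : realType) (t : R) : logloss (- t) = logloss t + t.
Proof.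
apply: expR_inj; rewrite expRD !lnK ?posrE ?addr_gt0 ?expR_gt0 // opprK.
by rewrite mulrDl mul1r -expRD addNr expR0 addrC.
Qed.

Lemma sigmoidN (R : realType) (t : R) : sigmoid (- t) = 1 - sigmoid t.
Proof.
rewrite /sigmoid opprK expRN; have := expR_gt0 t; move: (expR t) => e e0.
by field; rewrite !gt_eqF // addr_gt0.
Qed.

Lemma sigmoid_ge0 (R : realType) (t : R) : 0 <= sigmoid t.
Proof. by rewrite -expRN_logloss expR_ge0. Qed.

(** For [s <= t] the loss decreases, by at most [t - s], because [1 + exp (-s) <= (1 + exp (-t)) *
    exp (t - s)]. *)
Lemma logloss_lipschitz (R : realType) (s t : R) :
  `|logloss s - logloss t| <= `|s - t|.
Proof.
wlog st : s t / s <= t => [H|].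
  by have [/H //|/ltW /H] := leP s t; rewrite distrC [X in _ <= X]distrC.
have mono : logloss t <= logloss s.
  by rewrite ler_ln ?posrE ?addr_gt0 ?expR_gt0 // lerD2l ler_expR lerN2.
have growth : logloss s <= logloss t + (t - s).
  rewrite -ler_expR expRD !lnK ?posrE ?addr_gt0 ?expR_gt0 //.
  rewrite mulrDl mul1r -expRD addKr lerD2r.
  by rewrite -expR0 ler_expR subr_ge0.
by rewrite ger0_norm ?subr_ge0 // distrC ger0_norm ?subr_ge0 // lerBlDl.
Qed.

(* Squared total variation <= squared Hellinger distance <= relative entropy,
   for two Bernoulli laws given by their log-probabilities. *)
Lemma bernoulli_pinsker (R : realType) (a a' t t' : R) :
  expR (- a) + expR (- a') = 1 -> expR (- t) + expR (- t') = 1 ->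
  (expR (- a) - expR (- t)) ^+ 2 <=
  expR (- a) * (t - a) + expR (- a') * (t' - a').
Proof.
have half (z : R) : expR (- z) = expR (- z / 2) ^+ 2.
  by rewrite expr2 -expRD; congr expR; field.
(* This is [ln r <= r - 1] at the square root [r] of a likelihood ratio. Summed over both outcomes,
   it bounds the relative entropy below by [2 * (1 - (p * q + p' * q'))]. *)
have log_le (y z : R) :
    2 * (expR (- y / 2) ^+ 2 - expR (- y / 2) * expR (- z / 2)) <=
    expR (- y / 2) ^+ 2 * (z - y).
  have := expR_ge1Dx (- z / 2 + y / 2).
  rewrite expRD => H.
  have E : expR (- y / 2) * expR (y / 2) = 1.
    by rewrite mulNr -expRD addNr expR0.
  have := ler_wpM2l (sqr_ge0 (expR (- y / 2))) H.
  rewrite mulrCA [_ ^+ 2]expr2 -!mulrA E mulr1; lra.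
move=> ha ht; move: (log_le a t) (log_le a' t'); move: ha ht.
rewrite !half.
move: (expR (- a / 2)) (expR (- a' / 2)) (expR (- t / 2)) (expR (- t' / 2)).
move=> p p' q q' hp hq h h'.
(* The points [(p, p')] and [(q, q')] lie on the unit circle; up to sign, the cross terms are sines
   and cosines of the difference and the sum of their angles. *)
have cross : (p * q' - p' * q) ^+ 2 + (p * q + p' * q') ^+ 2 = 1.
  have -> : 1 = (p ^+ 2 + p' ^+ 2) * (q ^+ 2 + q' ^+ 2) by rewrite hp hq mulr1.
  ring.
have cross' : (p * q' + p' * q) ^+ 2 + (p * q - p' * q') ^+ 2 = 1.
  have -> : 1 = (p ^+ 2 + p' ^+ 2) * (q ^+ 2 + q' ^+ 2) by rewrite hp hq mulr1.
  ring.
have -> : p ^+ 2 - q ^+ 2 = (p * q' - p' * q) * (p * q' + p' * q).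
  have -> : p ^+ 2 - q ^+ 2 =
      p ^+ 2 * (q ^+ 2 + q' ^+ 2) - q ^+ 2 * (p ^+ 2 + p' ^+ 2).
    by rewrite hp hq; ring.
  ring.
apply: (@le_trans _ _ ((p * q' - p' * q) ^+ 2)).
  rewrite exprMn ler_piMr ?sqr_ge0 //.
  by rewrite -cross' lerDl sqr_ge0.
have := sqr_ge0 (p * q + p' * q' - 1); nra.
Qed.

(** Mean logistic loss of the prediction [t] when the label is [1] with probability [sigmoid a] and
    [-1] otherwise. *)
Definition cond_risk (R : realType) (a t : R) : R :=
  sigmoid a * logloss t + (1 - sigmoid a) * logloss (- t).

(** The excess risk is the relative entropy between the label laws with log-odds [a] and [t]. *)
Lemma cond_risk_lower (R : realType) (a t : R) :
  (sigmoid a - sigmoid t) ^+ 2 <= cond_risk a t - cond_risk a a.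
Proof.
have sum1 (z : R) : expR (- logloss z) + expR (- logloss (- z)) = 1.
  by rewrite !expRN_logloss sigmoidN addrC subrK.
have := bernoulli_pinsker (sum1 a) (sum1 t).
by rewrite !expRN_logloss sigmoidN /cond_risk; lra.
Qed.

(* [cond_risk a b - cond_risk a a] is the log-Laplace transform at [a - b] of a
   centred Bernoulli variable, which is bounded by symmetrization. *)
Lemma cond_risk_upper (R : realType) (a b : R) :
  cond_risk a b - cond_risk a a <= (a - b) ^+ 2 / 4.
Proof.
set p := sigmoid a; pose x := a - b.
have p0 : 0 <= p := sigmoid_ge0 a.
have p1 : p <= 1 by rewrite -subr_ge0 -sigmoidN sigmoid_ge0.
have -> : cond_risk a b - cond_risk a a = logloss b - logloss a - (1 - p) * x.
  by rewrite /cond_risk !loglossN -/p /x; ring.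
rewrite -ler_expR expRD.
have -> : expR (logloss b - logloss a) = p + (1 - p) * expR x.
  rewrite expRD expRN_logloss -/p lnK ?posrE ?addr_gt0 ?expR_gt0 //.
  have -> : - b = - a + x by rewrite /x; ring.
  have pE : p * (1 + expR (- a)) = 1.
    by rewrite /p /sigmoid div1r mulVf // gt_eqF // addr_gt0 // expR_gt0.
  rewrite expRD mulrDl mul1r mulrC mulrA.
  have -> : p * expR (- a) = 1 - p by rewrite -pE; ring.
  done.
(* Jensen's inequality replaces the mean [(1 - p) * x] by an independent copy of the variable. *)
have jensen : expR (- ((1 - p) * x)) <= p + (1 - p) * expR (- x).
  have := @expR_sum_le R bool (fun i => if i then p else 1 - p)
    (fun i => if i then 0 else - x).
  rewrite !big_bool /= mulr0 add0r expR0 mulr1 mulrN; apply.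
    by case; rewrite ?subr_ge0.
  by rewrite subrKC.
apply: (@le_trans _ _ ((p + (1 - p) * expR x) * (p + (1 - p) * expR (- x)))).
  by rewrite ler_wpM2l // addr_ge0 // mulr_ge0 ?expR_ge0 // subr_ge0.
have := expRDexpRN_le (x / 2).
set v := expR (x / 2); set v' := expR (- (x / 2)); set w := expR _ => hw.
have vv : v * v' = 1 by rewrite /v /v' -expRD subrr expR0.
have -> : expR x = v ^+ 2 by rewrite /v expr2 -expRD; congr expR; field.
have -> : expR (- x) = v' ^+ 2 by rewrite /v' expr2 -expRD; congr expR; field.
have -> : expR ((a - b) ^+ 2 / 4) = w ^+ 2.
  by rewrite /w [RHS]expr2 -expRD; congr expR; rewrite /x; field.
have v0 : 0 < v by apply: expR_gt0.
have v'0 : 0 < v' by apply: expR_gt0.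
(* This is the square of [cosh (x / 2)]; it dominates the product because [v * v' = 1] and
   [p * (1 - p) <= 1 / 4]. *)
apply: (@le_trans _ _ (((v + v') / 2) ^+ 2)); last first.
  by rewrite lerXn2r ?nnegrE ?expR_ge0 //; lra.
have -> : (p + (1 - p) * v ^+ 2) * (p + (1 - p) * v' ^+ 2) =
    1 + p * (1 - p) * (v - v') ^+ 2.
  have -> : (p + (1 - p) * v ^+ 2) * (p + (1 - p) * v' ^+ 2) =
     p ^+ 2 + (1 - p) ^+ 2 * (v * v') ^+ 2 + p * (1 - p) * (v ^+ 2 + v' ^+ 2).
    ring.
  have -> : (v - v') ^+ 2 = v ^+ 2 + v' ^+ 2 - 2 * (v * v') by ring.
  by rewrite vv; ring.
have -> : ((v + v') / 2) ^+ 2 = 1 + 1 / 4 * (v - v') ^+ 2.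
  have -> : ((v + v') / 2) ^+ 2 = v * v' + 1 / 4 * (v - v') ^+ 2 by field.
  by rewrite vv.
rewrite lerD2l ler_wpM2r ?sqr_ge0 //.
have := sqr_ge0 (p - 1 / 2); nra.
Qed.

Lemma sigmoid_sqr_le (R : realType) (a b t : R) :
  (sigmoid a - sigmoid t) ^+ 2 <=
  cond_risk a t - cond_risk a b + (a - b) ^+ 2 / 4.
Proof. have := cond_risk_lower a t; have := cond_risk_upper a b; lra. Qed.

(** * Contraction for Rademacher sums *)

(** Hypotheses will be indexed by the finitely many possible samples, so a maximum takes the place
    of a supremum over the l1-ball; [i0] witnesses nonemptiness. *)
Definition fmax (R : realType) (I : finType) (i0 : I) (F : I -> R) : R :=
  F [arg max_(i > i0) F i]%O.

Lemma fmax_ge (R : realType) (I : finType) (i0 : I) (F : I -> R) (i : I) :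
  F i <= fmax i0 F.
Proof. by rewrite /fmax; case: arg_maxP => //= j _; apply. Qed.

Lemma expR_diff_le (R : realType) (a b a' b' : R) :
  b <= b' -> b <= a -> a - b <= a' - b' ->
  expR a - expR b <= expR a' - expR b'.
Proof.
move=> bb' ba ab.
have diffE (y z : R) : expR y - expR z = expR z * (expR (y - z) - 1).
  by rewrite mulrBr mulr1 -expRD subrKC.
rewrite !diffE; apply: ler_pM; rewrite ?expR_ge0 ?ler_expR //.
  by rewrite subr_ge0 -expR0 ler_expR subr_ge0.
by rewrite lerD2r ler_expR.
Qed.

(** The subscripts refer to maximizers [t] of [a + f] and [s] of [a - f]; [A] and [B] bound [a + h]
    and [a - h] at both. If [ht] and [hs] have opposite signs, the exponentials are bounded
    separately; otherwise convexity in the form [expR_diff_le] applies, with base points ordered by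
    maximality. *)
Lemma contraction_real (R : realType) (at_ as_ ft fs ht hs A B : R) :
  `|ft| <= `|ht| -> `|fs| <= `|hs| -> `|ft - fs| <= `|ht - hs| ->
  as_ + fs <= at_ + ft -> at_ - ft <= as_ - fs ->
  at_ + ht <= A -> as_ + hs <= A -> at_ - ht <= B -> as_ - hs <= B ->
  expR (at_ + ft) + expR (as_ - fs) <= expR A + expR B.
Proof.
wlog ht0 : ht hs A B / 0 <= ht => [H|].
  move=> lt ls lts ot os tA sA tB sB.
  have [ht0|/ltW ht0] := leP 0 ht; first exact: (H ht hs).
  rewrite [leRHS]addrC; apply: (H (- ht) (- hs)); rewrite ?normrN ?oppr_ge0 //.
    by rewrite -opprD normrN.
- by rewrite opprK.
- by rewrite opprK.
rewrite (ger0_norm ht0) => /ler_normlP[lt1 lt2].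
have [hs0|/ltW hs0] := leP 0 hs.
  move=> /ler_normlP[]; rewrite ?(ger0_norm hs0) => ls1 ls2.
  have [hts|/ltW hts] := leP hs ht => /ler_normlP[d1 d2] ot os tA sA tB sB.
    rewrite ger0_norm ?subr_ge0 // in d1 d2.
    have key : expR (as_ - fs) - expR (as_ - hs) <=
        expR (at_ + ht) - expR (at_ + ft) by apply: expR_diff_le; lra.
    have eA : expR (at_ + ht) <= expR A by rewrite ler_expR.
    have eB : expR (as_ - hs) <= expR B by rewrite ler_expR.
    lra.
  rewrite ler0_norm ?subr_le0 // in d1 d2.
  have key : expR (at_ + ft) - expR (at_ - ht) <=
      expR (as_ + hs) - expR (as_ - fs) by apply: expR_diff_le; lra.
  have eA : expR (as_ + hs) <= expR A by rewrite ler_expR.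
  have eB : expR (at_ - ht) <= expR B by rewrite ler_expR.
  lra.
rewrite (ler0_norm hs0) => /ler_normlP[ls1 ls2] _ ot os tA sA tB sB.
by apply: lerD; rewrite ler_expR; lra.
Qed.

Lemma contraction_step (R : realType) (I : finType) (i0 : I) (a f h : I -> R) :
  (forall i, `|f i| <= `|h i|) ->
  (forall i j, `|f i - f j| <= `|h i - h j|) ->
  expR (fmax i0 (fun i => a i + f i)) + expR (fmax i0 (fun i => a i - f i)) <=
  expR (fmax i0 (fun i => a i + h i)) + expR (fmax i0 (fun i => a i - h i)).
Proof.
move=> fh fhL.
rewrite {1}/fmax; case: arg_maxP => //= t _ ot.
rewrite {1}/fmax; case: arg_maxP => //= s _ os.
apply: (@contraction_real _ _ _ _ _ (h t) (h s)); rewrite ?ot ?os //.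
- exact: (fmax_ge i0 (fun i => a i + h i) t).
- exact: (fmax_ge i0 (fun i => a i + h i) s).
- exact: (fmax_ge i0 (fun i => a i - h i) t).
- exact: (fmax_ge i0 (fun i => a i - h i) s).
Qed.

(** Serves both for sign vectors and for configurations, which have the same type. *)
Definition flip (n : nat) (k : 'I_n) (e : {ffun 'I_n -> bool}) :
  {ffun 'I_n -> bool} := [ffun j => if j == k then ~~ e j else e j].

Lemma flipK (n : nat) (k : 'I_n) : involutive (flip k).
Proof. by move=> e; apply/ffunP => j; rewrite !ffunE; case: eqP; rewrite ?negbK. Qed.

Lemma flip_diag (n : nat) (k : 'I_n) (e : {ffun 'I_n -> bool}) :
  flip k e k = ~~ e k.
Proof. by rewrite ffunE eqxx. Qed.

Lemma flip_off (n : nat) (k j : 'I_n) (e : {ffun 'I_n -> bool}) :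
  j != k -> flip k e j = e j.
Proof. by rewrite ffunE => /negbTE ->. Qed.

Lemma sum_flip (R : realType) (n : nat) (k : 'I_n)
    (F : {ffun 'I_n -> bool} -> R) : \sum_e F (flip k e) = \sum_e F e.
Proof. by rewrite [RHS](reindex_inj (inv_inj (@flipK n k))). Qed.

Lemma sum_flipD (R : realType) (n : nat) (k : 'I_n)
    (F : {ffun 'I_n -> bool} -> R) :
  \sum_e F e = 2^-1 * \sum_e (F e + F (flip k e)).
Proof. by rewrite big_split /= sum_flip; field. Qed.

Lemma spinN (R : realType) (b : bool) : spin R (~~ b) = - spin R b.
Proof. by case: b; rewrite /= ?opprK. Qed.

Definition sign_sum (R : realType) (I : finType) (n : nat)
  (f : 'I_n -> I -> R) (e : {ffun 'I_n -> bool}) (i : I) : R :=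
  \sum_k spin R (e k) * f k i.

(** Pairing [e] with [flip k e] leaves the contribution [a] of the other coordinates fixed, so
    [contraction_step] applies to each pair. *)
Lemma contraction_coord (R : realType) (I : finType) (i0 : I) (n : nat)
    (f g : 'I_n -> I -> R) (k : 'I_n) :
  (forall j, j != k -> f j = g j) ->
  (forall i, `|f k i| <= `|g k i|) ->
  (forall i j, `|f k i - f k j| <= `|g k i - g k j|) ->
  \sum_e expR (fmax i0 (sign_sum f e)) <= \sum_e expR (fmax i0 (sign_sum g e)).
Proof.
move=> fg le_fg lip_fg.
rewrite (sum_flipD k) [leRHS](sum_flipD k) ler_pM2l ?invr_gt0 //.
apply: ler_sum => e _.
pose a i := \sum_(j | j != k) spin R (e j) * f j i.
have sumE (h : 'I_n -> I -> R) : (forall j, j != k -> h j = f j) ->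
    (sign_sum h e = fun i => a i + spin R (e k) * h k i) /\
    (sign_sum h (flip k e) = fun i => a i - spin R (e k) * h k i).
  move=> hf; split; apply/funext => i.
    rewrite /sign_sum (bigD1 k) //= addrC; congr (_ + _).
    by apply: eq_bigr => j jk; rewrite hf.
  rewrite /sign_sum (bigD1 k) //= addrC flip_diag spinN mulNr; congr (_ - _).
  by apply: eq_bigr => j jk; rewrite hf // flip_off.
have [-> ->] := sumE f (fun _ _ => erefl).
have [-> ->] := sumE g (fun j jk => esym (fg j jk)).
apply: contraction_step => [i|i j]; rewrite -?mulrBr !normrM;
  exact: ler_wpM2l.
Qed.

(* Ledoux-Talagrand contraction, in its exponential form. *)
Lemma rademacher_contraction (R : realType) (I : finType) (i0 : I) (n : nat)
    (f g : 'I_n -> I -> R) :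
  (forall k i, `|f k i| <= `|g k i|) ->
  (forall k i j, `|f k i - f k j| <= `|g k i - g k j|) ->
  \sum_e expR (fmax i0 (sign_sum f e)) <= \sum_e expR (fmax i0 (sign_sum g e)).
Proof.
move=> le_fg lip_fg.
pose mix (s : seq 'I_n) k := if k \in s then g k else f k.
have mix_le s : \sum_e expR (fmax i0 (sign_sum f e)) <=
    \sum_e expR (fmax i0 (sign_sum (mix s) e)).
  elim: s => [//|k s IHs]; apply: (le_trans IHs).
  apply: (@contraction_coord _ _ _ _ _ _ k).
  - by move=> j jk; rewrite /mix in_cons (negbTE jk).
  - by move=> i; rewrite /mix mem_head; case: ifP.
  - by move=> i j; rewrite /mix mem_head; case: ifP.
have -> : g = mix (enum 'I_n).
  by apply/funext => k; rewrite /mix mem_enum.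
exact: mix_le.
Qed.

(** * Product measure and symmetrization *)

Definition iid (R : realType) (X : finType) (P : X -> R) (M : nat)
  (s : {ffun 'I_M -> X}) : R := \prod_k P (s k).

Lemma iid_ge0 (R : realType) (X : finType) (P : X -> R) (M : nat)
    (s : {ffun 'I_M -> X}) : (forall x, 0 <= P x) -> 0 <= iid P s.
Proof. by move=> P0; apply: prodr_ge0. Qed.

Lemma sum_iid (R : realType) (X : finType) (P f : X -> R) (M : nat) :
  \sum_(s : {ffun 'I_M -> X}) iid P s * \prod_k f (s k) =
  (\sum_x P x * f x) ^+ M.
Proof.
rewrite -[in RHS](card_ord M) -prodr_const bigA_distr_bigA /=.
by apply: eq_bigr => s _; rewrite /iid big_split.
Qed.

Lemma sum_iid1 (R : realType) (X : finType) (P : X -> R) (M : nat) :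
  \sum_x P x = 1 -> \sum_(s : {ffun 'I_M -> X}) iid P s = 1.
Proof.
move=> P1; rewrite -[RHS](expr1n _ M) -[in RHS]P1.
rewrite -(eq_bigr P (fun x _ => mulr1 (P x))) -sum_iid.
by apply: eq_bigr => s _; rewrite big1 ?mulr1.
Qed.

Definition swap (X : finType) (M : nat) (e : {ffun 'I_M -> bool})
    (p : {ffun 'I_M -> X} * {ffun 'I_M -> X}) :=
  ([ffun k => if e k then p.1 k else p.2 k],
   [ffun k => if e k then p.2 k else p.1 k]).

Lemma swapK (X : finType) (M : nat) (e : {ffun 'I_M -> bool}) :
  involutive (@swap X M e).
Proof.
by move=> [s s']; congr pair; apply/ffunP => k; rewrite !ffunE /= ?ffunE;
  case: (e k).
Qed.

Lemma iid_swap (R : realType) (X : finType) (P : X -> R) (M : nat)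
    (e : {ffun 'I_M -> bool}) (p : {ffun 'I_M -> X} * {ffun 'I_M -> X}) :
  iid P (swap e p).1 * iid P (swap e p).2 = iid P p.1 * iid P p.2.
Proof.
rewrite /iid -!big_split; apply: eq_bigr => k _ /=; rewrite !ffunE.
by case: (e k); rewrite // mulrC.
Qed.

(** The right side factors by independence, and Jensen's inequality applies to each factor. It
    serves to replace a population mean by a ghost sample. *)
Lemma jensen_iid (R : realType) (X : finType) (P f : X -> R) (M : nat) (c : R) :
  (forall x, 0 <= P x) -> \sum_x P x = 1 ->
  expR (M%:R * (c * \sum_x P x * f x)) <=
  \sum_(s : {ffun 'I_M -> X}) iid P s * expR (c * \sum_k f (s k)).
Proof.
move=> P0 P1.
rewrite (eq_bigr (fun s : {ffun 'I_M -> X} =>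
  iid P s * \prod_k expR (c * f (s k)))); last first.
  by move=> s _; rewrite mulr_sumr expR_sum.
rewrite (sum_iid P (fun x => expR (c * f x))) expRM_natl.
apply: lerXn2r; rewrite ?nnegrE ?expR_ge0 //.
  by apply: sumr_ge0 => x _; rewrite mulr_ge0 ?expR_ge0.
rewrite mulr_sumr (eq_bigr (fun x => P x * (c * f x))); last first.
  by move=> x _; rewrite mulrCA.
exact: expR_sum_le.
Qed.

(** By [2 * a * b <= a^2 + b^2]; it separates the sample from the ghost sample at the price of
    doubling the exponent. *)
Lemma expRD_le (R : realType) (u v : R) :
  expR (u + v) <= 2^-1 * (expR (2 * u) + expR (2 * v)).
Proof.
rewrite expRD !expRM_natl; have := sqr_ge0 (expR u - expR v); nra.
Qed.

Definition negf (n : nat) (e : {ffun 'I_n -> bool}) : {ffun 'I_n -> bool} :=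
  [ffun k => ~~ e k].

Lemma negfK (n : nat) : involutive (@negf n).
Proof. by move=> e; apply/ffunP => k; rewrite !ffunE negbK. Qed.

Lemma card_signs (R : realType) (n : nat) :
  \sum_(e : {ffun 'I_n -> bool}) 1 = 2 ^+ n :> R.
Proof. by rewrite sumr_const card_ffun card_bool card_ord natrX. Qed.

(* [sel] stands for any data-dependent choice of a hypothesis. *)
Lemma symmetrization (R : realType) (I X : finType) (i0 : I) (P : X -> R)
    (M : nat) (q : X -> I -> R) (c A : R) (sel : {ffun 'I_M -> X} -> I) :
  (forall x, 0 <= P x) -> \sum_x P x = 1 ->
  (forall s : {ffun 'I_M -> X},
     \sum_e expR (fmax i0 (sign_sum (fun k i => 2 * (c * q (s k) i)) e))
     <= 2 ^+ M * A) ->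
  \sum_s iid P s * expR (c * (M%:R * (\sum_x P x * q x (sel s))
                              - \sum_k q (s k) (sel s))) <= A.
Proof.
move=> P0 P1 rad.
(* [p.1] is the sample and [p.2] the ghost sample; the maximum removes the dependence on [sel]. *)
pose V (p : {ffun 'I_M -> X} * {ffun 'I_M -> X}) : R :=
  expR (fmax i0 (fun i => c * \sum_k (q (p.2 k) i - q (p.1 k) i))).
have ghost : \sum_s iid P s * expR (c * (M%:R * (\sum_x P x * q x (sel s))
      - \sum_k q (s k) (sel s))) <= \sum_p iid P p.1 * iid P p.2 * V p.
  rewrite -(pair_bigA _ (fun s s' => iid P s * iid P s' * V (s, s'))) /=.
  apply: ler_sum => s _.
  rewrite (eq_bigr (fun s' => iid P s * (iid P s' * V (s, s')))); last first.
    by move=> s' _; rewrite mulrA.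
  rewrite -mulr_sumr ler_wpM2l ?iid_ge0 //.
  rewrite mulrBr expRD mulrCA.
  apply: le_trans (ler_wpM2r (expR_ge0 _) (jensen_iid (q ^~ (sel s)) _ c P0 P1)) _.
  rewrite mulr_suml; apply: ler_sum => s' _.
  rewrite -mulrA ler_wpM2l ?iid_ge0 // -expRD -mulrBr ler_expR -sumrB.
  exact: (fmax_ge i0 (fun i => c * \sum_k (q (s' k) i - q (s k) i))).
apply: (le_trans ghost).
have sgn_ge0 : 0 < 2 ^+ M :> R by rewrite exprn_gt0.
(* Swaps preserve the product weight, so the mean of [V] equals its average over all [2 ^ M] swaps,
   which introduces the signs. *)
rewrite -(ler_pM2l sgn_ge0) -card_signs mulr_suml.
have swapE (e : {ffun 'I_M -> bool}) :
    1 * (\sum_p iid P p.1 * iid P p.2 * V p) =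
    \sum_p iid P p.1 * iid P p.2 * V (swap e p).
  rewrite mul1r (reindex_inj (inv_inj (@swapK X M e))).
  by apply: eq_bigr => p _; rewrite iid_swap.
rewrite (eq_bigr _ (fun e _ => swapE e)) exchange_big /= card_signs.
have weight1 : \sum_(p : {ffun 'I_M -> X} * {ffun 'I_M -> X})
    iid P p.1 * iid P p.2 = 1.
  rewrite -(pair_bigA _ (fun s s' => iid P s * iid P s')) /=.
  rewrite (eq_bigr (fun s => iid P s)) ?sum_iid1 // => s _.
  by rewrite -mulr_sumr sum_iid1 ?mulr1.
have -> : 2 ^+ M * A = \sum_(p : {ffun 'I_M -> X} * {ffun 'I_M -> X})
    iid P p.1 * iid P p.2 * (2 ^+ M * A) by rewrite -mulr_suml weight1 mul1r.
apply: ler_sum => p _; rewrite -mulr_sumr ler_wpM2l ?mulr_ge0 ?iid_ge0 //.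
pose rad2 (s : {ffun 'I_M -> X}) e : R :=
  expR (fmax i0 (sign_sum (fun k i => 2 * (c * q (s k) i)) e)).
(* The ghost sample carries the signs [e] and the sample the opposite ones; summing over all signs
   removes the difference. *)
apply: (@le_trans _ _ (\sum_e 2^-1 * (rad2 p.2 e + rad2 p.1 (negf e)))).
  apply: ler_sum => e _; rewrite /V {1}/fmax; move: [arg max_(_ > _) _]%O => i.
  have -> : c * \sum_k (q ((swap e p).2 k) i - q ((swap e p).1 k) i) =
      \sum_k spin R (e k) * (c * q (p.2 k) i) +
      \sum_k spin R (negf e k) * (c * q (p.1 k) i).
    rewrite mulr_sumr -big_split; apply: eq_bigr => k _; rewrite /= !ffunE.
    by case: (e k); rewrite /spin /=; ring.
  apply: (le_trans (expRD_le _ _)).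
  rewrite ler_pM2l ?invr_gt0 // lerD // ler_expR mulr_sumr.
    rewrite (eq_bigr (fun k => spin R (e k) * (2 * (c * q (p.2 k) i)))).
      exact: (fmax_ge i0 (sign_sum (fun k i => 2 * (c * q (p.2 k) i)) e)).
    by move=> k _; rewrite mulrCA.
  rewrite (eq_bigr (fun k => spin R (negf e k) * (2 * (c * q (p.1 k) i)))).
    exact: (fmax_ge i0 (sign_sum (fun k i => 2 * (c * q (p.1 k) i)) (negf e))).
  by move=> k _; rewrite mulrCA.
rewrite -mulr_sumr big_split /=.
have negE : \sum_e rad2 p.1 (negf e) = \sum_e rad2 p.1 e.
  by rewrite [RHS](reindex_inj (inv_inj (@negfK M))).
have rad_1 : \sum_e rad2 p.1 e <= 2 ^+ M * A := rad p.1.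
have rad_2 : \sum_e rad2 p.2 e <= 2 ^+ M * A := rad p.2.
by rewrite negE; lra.
Qed.

(** * Rademacher sums of linear functionals *)

Lemma rademacher_mgf (R : realType) (M : nat) (z : 'I_M -> R) (c : R) :
  (forall k, z k ^+ 2 = 1) ->
  \sum_(e : {ffun 'I_M -> bool}) expR (c * \sum_k spin R (e k) * z k) <=
  2 ^+ M * expR (M%:R * (c ^+ 2 / 2)).
Proof.
move=> z1.
rewrite (eq_bigr (fun e : {ffun 'I_M -> bool} =>
    \prod_k expR (c * (spin R (e k) * z k)))); last first.
  by move=> e _; rewrite mulr_sumr expR_sum.
rewrite -(bigA_distr_bigA (fun k b => expR (c * (spin R b * z k)))) /=.
rewrite expRM_natl -exprMn -[M in leRHS]card_ord -prodr_const.
apply: ler_prod => k _; rewrite big_bool /= addr_ge0 ?expR_ge0 //=.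
rewrite mul1r mulN1r mulrN.
by have := expRDexpRN_le (c * z k); rewrite exprMn z1 mulr1.
Qed.

(** Duality of the l1 and maximum norms bounds the linear functional by [B] times the largest
    [|v e j|]. The exponential at that entry is at most the sum over all features and both signs,
    whence the factor [2 * #|F|]. *)
Lemma rademacher_l1 (R : realType) (I F : finType) (i0 : I) (j0 : F) (M : nat)
    (D : I -> F -> R) (z : F -> 'I_M -> R) (B c : R) :
  0 <= c -> (forall j k, z j k ^+ 2 = 1) -> (forall i, \sum_j `|D i j| <= B) ->
  \sum_e expR (fmax i0 (sign_sum (fun k i => c * \sum_j D i j * z j k) e)) <=
  2 ^+ M * (2 * #|F|%:R * expR (M%:R * ((c * B) ^+ 2 / 2))).
Proof.
move=> c0 z1 DB.
pose v (e : {ffun 'I_M -> bool}) j := \sum_k spin R (e k) * z j k.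
have pick_le e : expR (fmax i0 (sign_sum (fun k i => c * \sum_j D i j * z j k) e))
    <= \sum_j (expR (c * B * v e j) + expR (- (c * B) * v e j)).
  rewrite /fmax; move: [arg max_(_ > _) _]%O => i.
  have -> : sign_sum (fun k i => c * \sum_j D i j * z j k) e i =
      c * \sum_j D i j * v e j.
    rewrite /sign_sum (eq_bigr (fun k => \sum_j c * (D i j * (spin R (e k) * z j k)))).
      rewrite exchange_big /= mulr_sumr; apply: eq_bigr => j _.
      by rewrite /v !mulr_sumr.
    by move=> k _; rewrite !mulr_sumr; apply: eq_bigr => j _; ring.
  have vmax j : `|v e j| <= fmax j0 (fun j => `|v e j|).
    exact: (fmax_ge j0 (fun j => `|v e j|)).
  move: vmax; rewrite /fmax; move: [arg max_(_ > _) _]%O => j vmax.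
  rewrite [leRHS](bigD1 j) //= -[leLHS]addr0 lerD //; last first.
    by apply: sumr_ge0 => j' _; rewrite addr_ge0 ?expR_ge0.
  have lin_le : c * \sum_j' D i j' * v e j' <= c * B * `|v e j|.
    rewrite -mulrA ler_wpM2l //.
    apply: (@le_trans _ _ (\sum_j' `|D i j'| * `|v e j|)).
      apply: ler_sum => j' _; apply: (le_trans (ler_norm _)).
      by rewrite normrM ler_wpM2l.
    by rewrite -mulr_suml ler_wpM2r.
  have [v0|/ltW v0] := leP 0 (v e j).
    rewrite (ger0_norm v0) in lin_le; rewrite -[leLHS]addr0 lerD ?expR_ge0 //.
    by rewrite ler_expR.
  rewrite (ler0_norm v0) in lin_le; rewrite -[leLHS]add0r lerD ?expR_ge0 //.
  by rewrite ler_expR mulNr -mulrN.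
apply: (le_trans (ler_sum _ (fun e _ => pick_le e))).
rewrite exchange_big /=.
set K := expR _.
have -> : 2 ^+ M * (2 * #|F|%:R * K) = \sum_(j : F) (2 * (2 ^+ M * K)).
  by rewrite sumr_const -[RHS]mulr_natr; ring.
apply: ler_sum => j _; rewrite big_split /= [leRHS]mulr_natl mulr2n.
apply: lerD; last rewrite /K -sqrrN; exact: rademacher_mgf.
Qed.

(** * Parity functions and Fourier expansion *)

Lemma spin_sqr (R : realType) (b : bool) : spin R b * spin R b = 1.
Proof. by case: b; rewrite /= ?mulr1 // mulrNN mulr1. Qed.

Lemma norm_spin (R : realType) (b : bool) : `|spin R b| = 1.
Proof. by case: b; rewrite /= ?normrN normr1. Qed.

Lemma chi_sqr (R : realType) (n : nat) (T : {set 'I_n}) (x : cfg n) :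
  chi R T x ^+ 2 = 1.
Proof.
by rewrite expr2 /chi -big_split big1 // => i _; rewrite /= spin_sqr.
Qed.

Lemma norm_chi (R : realType) (n : nat) (T : {set 'I_n}) (x : cfg n) :
  `|chi R T x| = 1.
Proof. by rewrite /chi normr_prod big1 // => i _; exact: norm_spin. Qed.

Lemma chi_off (R : realType) (n : nat) (T : {set 'I_n}) (x y : cfg n) :
  {in T, x =1 y} -> chi R T x = chi R T y.
Proof. by move=> xy; apply: eq_bigr => i iT; rewrite xy. Qed.

Lemma chi_D1 (R : realType) (n : nat) (T : {set 'I_n}) (u : 'I_n) (x : cfg n) :
  u \in T -> chi R T x = spin R (x u) * chi R (T :\ u) x.
Proof. by move=> uT; rewrite /chi (big_setD1 u). Qed.

Lemma chi_flip_notin (R : realType) (n : nat) (T : {set 'I_n}) (u : 'I_n)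
    (x : cfg n) : u \notin T -> chi R T (flip u x) = chi R T x.
Proof.
move=> uT; apply: chi_off => i iT; rewrite flip_off //.
by apply: contraNneq uT => <-.
Qed.

Lemma chi_flip (R : realType) (n : nat) (T : {set 'I_n}) (u : 'I_n) (x : cfg n) :
  u \in T -> chi R T (flip u x) = - chi R T x.
Proof.
move=> uT; rewrite !(chi_D1 _ _ uT) flip_diag spinN chi_flip_notin ?mulNr //.
by rewrite !inE eqxx.
Qed.

Lemma sum_chi_eq0 (R : realType) (n : nat) (T : {set 'I_n}) (i : 'I_n)
    (F : cfg n -> R) :
  i \in T -> (forall x, F (flip i x) = F x) -> \sum_x F x * chi R T x = 0.
Proof.
move=> iT Fi; rewrite (sum_flipD i) big1 ?mulr0 // => x _.
by rewrite Fi chi_flip // mulrN subrr.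
Qed.

Lemma sum_chi_chi (R : realType) (n : nat) (x y : cfg n) :
  \sum_T chi R T x * chi R T y = if x == y then 2 ^+ n else 0.
Proof.
(* Expanding the product amounts to choosing a set [T] of factors. If [x] and [y] differ at [i], the
   factor at [i] is [-1 + 1]. *)
have -> : \sum_T chi R T x * chi R T y =
    \prod_i (spin R (x i) * spin R (y i) + 1).
  rewrite bigA_distr; apply: eq_bigr => T _.
  by rewrite /chi -big_split big_mkcond.
have [->|neq] := eqVneq x y.
  rewrite (eq_bigr (fun=> 2)); first by rewrite prodr_const card_ord.
  by move=> i _; rewrite spin_sqr.
have [i xyi] : exists i, x i != y i.
  apply/existsP; apply: contraNT neq; rewrite negb_exists => /forallP xy.
  by apply/eqP/ffunP => i; apply/eqP; rewrite -[_ == _]negbK.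
rewrite (bigD1 i) //=; have -> : y i = ~~ x i by case: (x i) (y i) xyi => [] [].
by rewrite spinN mulrN spin_sqr addNr mul0r.
Qed.

Lemma rbm_f_fourier (R : realType) (n m : nat) (J : 'M[R]_(n, m))
    (h : 'I_n -> R) (g : 'I_m -> R) (x : cfg n) :
  rbm_f J h g x = \sum_T fhat J h g T * chi R T x.
Proof.
rewrite /fhat.
rewrite (eq_bigr (fun T => (2 ^+ n)^-1 *
   \sum_y rbm_f J h g y * (chi R T y * chi R T x))); last first.
  move=> T _; rewrite -mulrA mulr_suml; congr (_ * _).
  by apply: eq_bigr => y _; rewrite mulrA.
rewrite -mulr_sumr exchange_big /=.
rewrite (bigD1 x) //= [X in _ + X]big1 => [|y yx].
  rewrite -mulr_sumr sum_chi_chi eqxx addr0 mulrCA mulVf ?mulr1 //.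
  by rewrite expf_neq0 ?pnatr_eq0.
by rewrite -mulr_sumr sum_chi_chi (negbTE yx) mulr0.
Qed.

(** * Marginal law and conditional law of an observed variable *)

(** Latent spins are independent given [x]: the sum over [y] factors over [j], with factors
    [expR (rho (t j))]. *)
Lemma marg_weightE (R : realType) (n m : nat) (J : 'M[R]_(n, m))
    (h : 'I_n -> R) (g : 'I_m -> R) (x : cfg n) :
  marg_weight J h g x = expR (rbm_f J h g x).
Proof.
pose t j := \sum_(i < n) J i j * spin R (x i) + g j.
rewrite /rbm_f expRD expR_sum.
rewrite (eq_bigr (fun j => \sum_b expR (t j * spin R b))); last first.
  move=> j _; rewrite /rho lnK ?posrE ?addr_gt0 ?expR_gt0 // big_bool /=.
  by rewrite mulr1 mulrN1.
rewrite bigA_distr_bigA mulr_suml; apply: eq_bigr => y _.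
rewrite -expR_sum -expRD /rbm_weight exchange_big /= addrAC -big_split /=.
congr (expR (_ + _)); apply: eq_bigr => j _.
rewrite /t mulrDl mulr_suml; congr (_ + _); apply: eq_bigr => i _.
by rewrite [_ * J i j]mulrC.
Qed.

Lemma partition_gt0 (R : realType) (n m : nat) (J : 'M[R]_(n, m))
    (h : 'I_n -> R) (g : 'I_m -> R) :
  0 < \sum_(x : cfg n) marg_weight J h g x.
Proof.
rewrite (bigD1 [ffun=> true]) //= ltr_pwDl ?marg_weightE ?expR_gt0 //.
by apply: sumr_ge0 => y _; rewrite marg_weightE expR_ge0.
Qed.

Lemma marg_pmf_gt0 (R : realType) (n m : nat) (J : 'M[R]_(n, m))
    (h : 'I_n -> R) (g : 'I_m -> R) (x : cfg n) : 0 < marg_pmf J h g x.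
Proof. by rewrite divr_gt0 ?partition_gt0 // marg_weightE expR_gt0. Qed.

Lemma marg_pmf_ge0 (R : realType) (n m : nat) (J : 'M[R]_(n, m))
    (h : 'I_n -> R) (g : 'I_m -> R) (x : cfg n) : 0 <= marg_pmf J h g x.
Proof. exact/ltW/marg_pmf_gt0. Qed.

Lemma sum_marg_pmf (R : realType) (n m : nat) (J : 'M[R]_(n, m))
    (h : 'I_n -> R) (g : 'I_m -> R) : \sum_x marg_pmf J h g x = 1.
Proof. by rewrite -mulr_suml divff // gt_eqF // partition_gt0. Qed.

(** The partition function cancels. With [y] equal to [x] flipped at [u], this gives the conditional
    law of [X_u]. *)
Lemma marg_pmf_ratio (R : realType) (n m : nat) (J : 'M[R]_(n, m))
    (h : 'I_n -> R) (g : 'I_m -> R) (x y : cfg n) :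
  marg_pmf J h g x =
  (marg_pmf J h g x + marg_pmf J h g y) *
    sigmoid (rbm_f J h g x - rbm_f J h g y).
Proof.
rewrite /marg_pmf !marg_weightE /sigmoid opprB expRB.
have := partition_gt0 J h g; move: (\sum_x' _) => Z Z0.
have := expR_gt0 (rbm_f J h g x); have := expR_gt0 (rbm_f J h g y).
move: (expR _) (expR _) => ey ex ey0 ex0.
by field; rewrite !gt_eqF // addr_gt0.
Qed.

(* The difference of [rbm_f] between [X_u = 1] and [X_u = -1]. *)
Definition log_odds (R : realType) (n m : nat) (J : 'M[R]_(n, m))
    (h : 'I_n -> R) (g : 'I_m -> R) (u : 'I_n) (x : cfg n) : R :=
  \sum_(T : {set 'I_n} | u \in T) 2 * fhat J h g T * chi R (T :\ u) x.

Lemma log_odds_eq (R : realType) (n m : nat) (J : 'M[R]_(n, m))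
    (h : 'I_n -> R) (g : 'I_m -> R) (u : 'I_n) (x y : cfg n) :
  (forall i, i != u -> x i = y i) -> log_odds J h g u x = log_odds J h g u y.
Proof.
move=> xy; apply: eq_bigr => T uT; congr (_ * _); apply: chi_off => i.
by rewrite !inE => /andP[/xy].
Qed.

(** Only the terms with [u] in [T] change sign, which produces the factor [2] in [log_odds]. *)
Lemma rbm_f_flip (R : realType) (n m : nat) (J : 'M[R]_(n, m))
    (h : 'I_n -> R) (g : 'I_m -> R) (u : 'I_n) (x : cfg n) :
  rbm_f J h g x - rbm_f J h g (flip u x) = spin R (x u) * log_odds J h g u x.
Proof.
rewrite !rbm_f_fourier -sumrB (bigID [pred T : {set 'I_n} | u \in T]) /=.
rewrite [X in _ + X]big1 ?addr0 => [|T uT]; last first.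
  by rewrite chi_flip_notin // subrr.
rewrite /log_odds mulr_sumr; apply: eq_bigr => T uT.
by rewrite chi_flip // (chi_D1 _ _ uT); ring.
Qed.

Lemma marg_pmf_flip (R : realType) (n m : nat) (J : 'M[R]_(n, m))
    (h : 'I_n -> R) (g : 'I_m -> R) (u : 'I_n) (x : cfg n) :
  marg_pmf J h g x =
  (marg_pmf J h g x + marg_pmf J h g (flip u x)) *
    sigmoid (spin R (x u) * log_odds J h g u x).
Proof. by rewrite -rbm_f_flip -marg_pmf_ratio. Qed.

Lemma cond_prob1E (R : realType) (n m : nat) (J : 'M[R]_(n, m))
    (h : 'I_n -> R) (g : 'I_m -> R) (u : 'I_n) (x : cfg n) :
  cond_prob1 J h g u x = sigmoid (log_odds J h g u x).
Proof.
have flipE : flip u (setc x u true) = setc x u false.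
  by apply/ffunP => i; rewrite !ffunE; case: eqP.
rewrite /cond_prob1; have := marg_pmf_flip J h g u (setc x u true).
rewrite flipE {3}/setc ffunE eqxx mul1r.
rewrite (@log_odds_eq _ _ _ J h g u (setc x u true) x); last first.
  by move=> i /negbTE iu; rewrite ffunE iu.
move=> {1}->; rewrite mulrAC divff ?mul1r // gt_eqF //.
by rewrite addr_gt0 ?marg_pmf_gt0.
Qed.

(** * Truncation of the log-odds to the given features *)

Lemma sum_feat_idx (R : realType) (n : nat) (nu : {set 'I_n}) (u : 'I_n)
    (G : {set 'I_n} -> R) : u \notin nu ->
  \sum_(T : feat_idx nu) G (val T) =
  \sum_(T : {set 'I_n} | (u \in T) && (T :\ u \subset nu)) G (T :\ u).
Proof.
move=> unu; symmetry.
rewrite (reindex_omap (fun T : feat_idx nu => u |: val T)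
  (fun T => insub (T :\ u))) /=; last first.
  move=> T /andP[uT Tnu]; case: insubP => [j _ jE|]; last by rewrite Tnu.
  by rewrite /= jE setD1K.
have notin (T : feat_idx nu) : u \notin val T.
  by apply: contra unu; exact: (subsetP (valP T)).
apply: eq_big => [T|T _]; last by rewrite (setU1K (notin T)).
by rewrite (setU1K (notin T)) setU11 (valP T) valK eqxx.
Qed.

Definition wstar (R : realType) (n m : nat) (J : 'M[R]_(n, m))
    (h : 'I_n -> R) (g : 'I_m -> R) (nu : {set 'I_n}) (u : 'I_n)
    (T : feat_idx nu) : R := 2 * fhat J h g (u |: val T).

Lemma wdot_wstar (R : realType) (n m : nat) (J : 'M[R]_(n, m))
    (h : 'I_n -> R) (g : 'I_m -> R) (nu : {set 'I_n}) (u : 'I_n) (x : cfg n) :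
  u \notin nu ->
  wdot (wstar J h g (nu := nu) u) x =
  \sum_(T : {set 'I_n} | (u \in T) && (T :\ u \subset nu))
     2 * fhat J h g T * chi R (T :\ u) x.
Proof.
move=> unu.
rewrite /wdot (sum_feat_idx (fun S => 2 * fhat J h g (u |: S) * chi R S x) unu).
by apply: eq_bigr => T /andP[uT _]; rewrite setD1K.
Qed.

Lemma gammax_ge (R : realType) (n m : nat) (J : 'M[R]_(n, m))
    (h : 'I_n -> R) (g : 'I_m -> R) (u : 'I_n) :
  \sum_(T : {set 'I_n} | u \in T) `|fhat J h g T| <= gammax J h g.
Proof.
exact: (le_bigmax _ (fun u => \sum_(T : {set 'I_n} | u \in T) `|fhat J h g T|)).
Qed.

Lemma gammax_ge0 (R : realType) (n m : nat) (J : 'M[R]_(n, m))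
    (h : 'I_n -> R) (g : 'I_m -> R) : 0 <= gammax J h g.
Proof. exact: bigmax_ge_id. Qed.

Lemma norm1_wstar (R : realType) (n m : nat) (J : 'M[R]_(n, m))
    (h : 'I_n -> R) (g : 'I_m -> R) (nu : {set 'I_n}) (u : 'I_n) :
  u \notin nu -> norm1 (wstar J h g (nu := nu) u) <= 2 * gammax J h g.
Proof.
move=> unu.
rewrite /norm1 (sum_feat_idx (fun S => `|2 * fhat J h g (u |: S)|) unu).
apply: le_trans (ler_wpM2l _ (gammax_ge J h g u)) => //.
rewrite mulr_sumr [leRHS](bigID (fun T : {set 'I_n} => T :\ u \subset nu)) /=.
rewrite -[leLHS]addr0 lerD ?sumr_ge0 //; last by move=> T _; rewrite mulr_ge0.
by apply: ler_sum => T /andP[uT _]; rewrite setD1K // normrM ger0_norm.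
Qed.

(* A nonempty set of at most [d] elements is the image of a function on ['I_d]. *)
Lemma card_small_subsets (K : finType) (A : {set K}) (d : nat) :
  (#|[set S : {set K} | [&& S \subset A, S != set0 & #|S| <= d]]|
     <= #|A| ^ d)%N.
Proof.
rewrite -[d in (_ ^ d)%N]card_ord -(@card_ffun_on 'I_d K (mem A)).
pose im (f : {ffun 'I_d -> K}) := [set f i | i : 'I_d].
apply: leq_trans (leq_imset_card im (mem (ffun_on (mem A)))).
apply: subset_leq_card; apply/subsetP => S; rewrite !inE => /and3P[SA S0 Sd].
have [s0 s0S] := set0Pn _ S0.
have in_S (i : nat) : nth s0 (enum S) i \in S.
  have [iS|iS] := ltnP i (size (enum S)); last by rewrite nth_default.
  by rewrite -mem_enum mem_nth.
apply/imsetP; exists [ffun i : 'I_d => nth s0 (enum S) i].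
  by apply/ffun_onP => i; rewrite ffunE; apply/(subsetP SA)/in_S.
apply/setP => s; apply/idP/imsetP => [sS|[i _ ->]]; last by rewrite ffunE.
have sd : (index s (enum S) < d)%N.
  by apply: leq_trans Sd; rewrite cardE index_mem mem_enum.
by exists (Ordinal sd); rewrite // ffunE nth_index // mem_enum.
Qed.

(** If [T] has more than [dmax J] elements, each [rho] term ignores some element of [T]; if it has
    more than one, so does each linear term. Flipping that element preserves the term and negates
    [chi R T], so every term is orthogonal to [chi R T]. *)
Lemma fhat_neq0_card (R : realType) (n m : nat) (J : 'M[R]_(n, m))
    (h : 'I_n -> R) (g : 'I_m -> R) (T : {set 'I_n}) :
  (1 < #|T|)%N -> fhat J h g T != 0 -> (#|T| <= dmax J)%N.
Proof.
move=> T1; apply: contraR; rewrite -ltnNge => dT.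
rewrite /fhat /rbm_f; apply/eqP.
rewrite (eq_bigr (fun x : cfg n =>
    \sum_(j < m) rho (\sum_(i < n) J i j * spin R (x i) + g j) * chi R T x +
    \sum_(i < n) h i * spin R (x i) * chi R T x)); last first.
  by move=> x _; rewrite mulrDl !mulr_suml.
rewrite big_split /= exchange_big /= [X in _ + X]exchange_big /=.
rewrite !big1 ?addr0 ?mulr0 // => [i _|j _].
  have [k kT ki] : exists2 k, k \in T & k != i.
    have /card_gt0P[k] : (0 < #|T :\ i|)%N.
      by move: T1; rewrite (cardsD1 i); case: (i \in T) => //= /ltnW.
    by rewrite !inE => /andP[ki kT]; exists k.
  apply: (sum_chi_eq0 (F := fun x : cfg n => h i * spin R (x i)) kT) => x.
  by rewrite flip_off // eq_sym.
have [k kT kj] : exists2 k, k \in T & J k j == 0.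
  apply/exists_inP; apply: contraTT dT; rewrite -leqNgt.
  rewrite negb_exists_in => /forall_inP Tj.
  apply: leq_trans (leq_bigmax j).
  by apply/subset_leq_card/subsetP => k kT; rewrite inE Tj.
apply: (sum_chi_eq0 (F := fun x : cfg n =>
  rho (\sum_(i < n) J i j * spin R (x i) + g j)) kT) => x.
congr rho; congr (_ + _); apply: eq_bigr => i _.
have [->|ik] := eqVneq i k; first by rewrite (eqP kj) !mul0r.
by rewrite flip_off.
Qed.

Lemma small_fhat_sum (R : realType) (n m : nat) (J : 'M[R]_(n, m))
    (h : 'I_n -> R) (g : 'I_m -> R) (zeta : R) (nu : {set 'I_n}) (u : 'I_n) :
  0 < zeta ->
  (forall i (T : {set 'I_n}), i != u -> u \in T -> i \in T ->
     zeta <= `|fhat J h g T| -> i \in nu) ->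
  \sum_(T : {set 'I_n} | (u \in T) && ~~ (T :\ u \subset nu)) `|fhat J h g T|
  <= zeta * (Dmax J h g)%:R ^+ dmax J.
Proof.
move=> zeta0 large.
pose small := [set T : {set 'I_n} |
  [&& u \in T, ~~ (T :\ u \subset nu) & fhat J h g T != 0]].
apply: (@le_trans _ _ (\sum_(T in small) zeta)).
  rewrite big_mkcond [leRHS]big_mkcond; apply: ler_sum => T _; rewrite inE.
  case: (boolP (u \in T)) => //= uT; case: ifP => //= Tnu.
  have [->|fT] := eqVneq (fhat J h g T) 0; first by rewrite normr0.
  have /subsetPn[i] := Tnu; rewrite !inE => /andP[iu iT] inu.
  by rewrite leNgt; apply: contra inu => /ltW; exact: large.
rewrite sumr_const -[leLHS]mulr_natr ler_pM2l // -natrX ler_nat.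
(* The sets [T :\ u] are counted instead: they are nonempty subsets of the neighborhood with at most
   [dmax J] elements. *)
have inj : {in small &, injective (fun T : {set 'I_n} => T :\ u)}.
  move=> T T'; rewrite !inE => /andP[uT _] /andP[uT' _] TT'.
  by rewrite -(setD1K uT) -(setD1K uT') TT'.
rewrite -(card_in_imset inj).
apply: (@leq_trans (#|mrf_nbhd J h g u| ^ dmax J)%N); last first.
  case: (dmax J) => [|d]; first by rewrite !expn0.
  by rewrite leq_exp2r // (leq_bigmax u).
apply: leq_trans (card_small_subsets _ _).
apply: subset_leq_card; apply/subsetP => _ /imsetP[T + ->].
rewrite !inE => /and3P[uT Tnu fT].
(* The singleton of [u] is never dropped, since the empty set is contained in [nu]. *)
have Tu0 : T :\ u != set0 by apply: contraNneq Tnu => ->; rewrite sub0set.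
have T1 : (1 < #|T|)%N by rewrite (cardsD1 u) uT ltnS card_gt0.
apply/and3P; split => //.
  apply/subsetP => i; rewrite !inE => /andP[iu iT]; rewrite iu.
  by apply/existsP; exists T; rewrite uT iT.
apply: leq_trans (fhat_neq0_card T1 fT).
by rewrite subset_leq_card // subD1set.
Qed.

Lemma log_odds_approx (R : realType) (n m : nat) (J : 'M[R]_(n, m))
    (h : 'I_n -> R) (g : 'I_m -> R) (zeta : R) (nu : {set 'I_n}) (u : 'I_n)
    (x : cfg n) :
  0 < zeta -> u \notin nu ->
  (forall i (T : {set 'I_n}), i != u -> u \in T -> i \in T ->
     zeta <= `|fhat J h g T| -> i \in nu) ->
  `|log_odds J h g u x - wdot (wstar J h g (nu := nu) u) x| <=
  2 * (zeta * (Dmax J h g)%:R ^+ dmax J).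
Proof.
move=> zeta0 unu large.
rewrite wdot_wstar // /log_odds.
rewrite (bigID (fun T : {set 'I_n} => T :\ u \subset nu)) /= [X in `|X|]addrC addKr.
apply: le_trans (ler_wpM2l _ (small_fhat_sum zeta0 large)) => //.
rewrite mulr_sumr; apply: (le_trans (ler_norm_sum _ _ _)).
by apply: ler_sum => T _; rewrite !normrM norm_chi mulr1 ger0_norm.
Qed.

(** * Prediction error and excess loss *)

Lemma wdot_flip (R : realType) (n : nat) (nu : {set 'I_n}) (u : 'I_n)
    (w : feat_idx nu -> R) (x : cfg n) :
  u \notin nu -> wdot w (flip u x) = wdot w x.
Proof.
move=> unu; apply: eq_bigr => T _; rewrite chi_flip_notin //.
by apply: contra unu; exact: (subsetP (valP T)).
Qed.

Lemma norm_wdot_le (R : realType) (n : nat) (nu : {set 'I_n})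
    (w : feat_idx nu -> R) (x : cfg n) : `|wdot w x| <= norm1 w.
Proof.
apply: (le_trans (ler_norm_sum _ _ _)); apply: ler_sum => T _.
by rewrite normrM norm_chi mulr1.
Qed.

Lemma wdotB (R : realType) (n : nat) (nu : {set 'I_n})
    (w w' : feat_idx nu -> R) (x : cfg n) :
  wdot w x - wdot w' x = \sum_T (w T - w' T) * chi R (val T) x.
Proof. by rewrite -sumrB; apply: eq_bigr => T _; rewrite mulrBl. Qed.

Lemma card_feat_idx (n : nat) (nu : {set 'I_n}) :
  #|{: feat_idx nu}| = (2 ^ #|nu|)%N.
Proof.
rewrite card_sig -card_powerset; apply: eq_card => T.
by rewrite !inE.
Qed.

Definition excess_loss (R : realType) (n : nat) (nu : {set 'I_n}) (u : 'I_n)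
    (w w' : feat_idx nu -> R) (x : cfg n) : R :=
  logloss (spin R (x u) * wdot w x) - logloss (spin R (x u) * wdot w' x).

(** Pairing [x] with [flip u x] conditions on the other variables: the expected loss of a pair
    becomes a [cond_risk], and [sigmoid_sqr_le] applies pair by pair. *)
Lemma pred_error_le (R : realType) (n m : nat) (J : 'M[R]_(n, m))
    (h : 'I_n -> R) (g : 'I_m -> R) (nu : {set 'I_n}) (u : 'I_n)
    (w w' : feat_idx nu -> R) (K : R) :
  u \notin nu ->
  (forall x, (log_odds J h g u x - wdot w' x) ^+ 2 <= K) ->
  pred_error J h g u w <=
  \sum_x marg_pmf J h g x * excess_loss u w w' x + K / 4.
Proof.
move=> unu Kbound.
have -> : K / 4 = \sum_x marg_pmf J h g x * (K / 4).
  by rewrite -mulr_suml sum_marg_pmf mul1r.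
rewrite -big_split /= /pred_error (sum_flipD u) [leRHS](sum_flipD u).
rewrite ler_pM2l ?invr_gt0 //; apply: ler_sum => x _.
have oddsE : log_odds J h g u (flip u x) = log_odds J h g u x.
  by apply: log_odds_eq => i iu; rewrite flip_off.
have pE := marg_pmf_flip J h g u x.
have pE' := marg_pmf_flip J h g u (flip u x).
rewrite flipK oddsE flip_diag spinN mulNr addrC in pE'.
rewrite /excess_loss !cond_prob1E oddsE !wdot_flip // flip_diag spinN !mulNr.
have Q0 : 0 <= marg_pmf J h g x + marg_pmf J h g (flip u x).
  by rewrite addr_ge0 ?marg_pmf_ge0.
move: pE pE' Q0; move: (_ + marg_pmf _ _ _ _) => Q -> -> Q0.
have := sigmoid_sqr_le (log_odds J h g u x) (wdot w' x) (wdot w x).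
have := Kbound x; move: (log_odds J h g u x) (wdot w' x) (wdot w x) => a b t.
move=> abK key.
have {}key : (sigmoid a - sigmoid t) ^+ 2 <=
    cond_risk a t - cond_risk a b + K / 4 by lra.
have := ler_wpM2l Q0 key; rewrite /cond_risk.
by case: (x u); rewrite /= ?mul1r ?mulN1r ?opprK sigmoidN; lra.
Qed.

(** * Concentration of the excess loss *)

(** At each sample point the excess loss is a 1-Lipschitz function of [wdot (w i) x - wdot w' x]
    that vanishes at [0]. Contraction leaves a linear functional with coefficients of l1-norm at
    most [2 * B] on [2 ^ #|nu|] features. *)
Lemma regression_mgf (R : realType) (I : finType) (i0 : I) (n M : nat)
    (nu : {set 'I_n}) (u : 'I_n) (w : I -> feat_idx nu -> R)
    (w' : feat_idx nu -> R) (B c : R) (s : {ffun 'I_M -> cfg n}) :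
  0 <= c -> (forall i, norm1 (w i) <= B) -> norm1 w' <= B ->
  \sum_e expR (fmax i0
    (sign_sum (fun k i => 2 * (c * excess_loss u (w i) w' (s k))) e)) <=
  2 ^+ M * (2 * 2 ^+ #|nu| * expR (M%:R * ((2 * c * (2 * B)) ^+ 2 / 2))).
Proof.
move=> c0 wB w'B.
have set0nu : set0 \subset nu by rewrite sub0set.
have c20 : 0 <= 2 * c by rewrite mulr_ge0.
have diffB i : \sum_T `|w i T - w' T| <= 2 * B.
  apply: (@le_trans _ _ (norm1 (w i) + norm1 w')); last first.
    by have := wB i; lra.
  by rewrite -big_split; apply: ler_sum => T _; rewrite /= ler_normB.
have := @rademacher_l1 R I (feat_idx nu) i0 (exist _ set0 set0nu) M
  (fun i T => w i T - w' T) (fun T k => chi R (val T) (s k)) (2 * B) (2 * c)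
  c20 (fun T k => chi_sqr _ _ _) diffB.
rewrite card_feat_idx natrX => rad; apply: (le_trans _ rad).
apply: rademacher_contraction => [k i|k i j].
  rewrite mulrA normrM [leRHS]normrM ler_wpM2l // -wdotB /excess_loss.
  apply: (le_trans (logloss_lipschitz _ _)).
  by rewrite -mulrBr normrM norm_spin mul1r.
rewrite !mulrA -!mulrBr normrM [leRHS]normrM ler_wpM2l //.
rewrite -!wdotB /excess_loss !opprB !addrA !subrK.
apply: (le_trans (logloss_lipschitz _ _)).
by rewrite -mulrBr normrM norm_spin mul1r.
Qed.

(* Chernoff bound, at the optimal parameter [c = t / (16 B^2)]. *)
Lemma regression_tail (R : realType) (n M : nat) (P : cfg n -> R)
    (nu : {set 'I_n}) (u : 'I_n)
    (w : {ffun 'I_M -> cfg n} -> feat_idx nu -> R)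
    (w' : feat_idx nu -> R) (B t : R) :
  (forall x, 0 <= P x) -> \sum_x P x = 1 ->
  0 < B -> 0 <= t -> (forall s, norm1 (w s) <= B) -> norm1 w' <= B ->
  \sum_(s | M%:R * t <= M%:R * (\sum_x P x * excess_loss u (w s) w' x)
                        - \sum_k excess_loss u (w s) w' (s k)) iid P s <=
  2 * 2 ^+ #|nu| * expR (- (M%:R * t ^+ 2 / (32 * B ^+ 2))).
Proof.
move=> P0 P1 B0 t0 wB w'B.
pose c := t / (16 * B ^+ 2).
have c0 : 0 <= c by rewrite divr_ge0 // mulr_ge0 // sqr_ge0.
(* Hypotheses are indexed by the samples that produce them: [sel] is the identity, and [i0] is an
   arbitrary sample. *)
have mgf := symmetrization (i0 := [ffun=> [ffun=> true]])
  (q := fun x s => excess_loss u (w s) w' x) id P0 P1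
  (fun s => regression_mgf [ffun=> [ffun=> true]] u s c0 wB w'B).
(* The total exponent is [M * (8 * c^2 * B^2 - c * t)]. *)
have -> : expR (- (M%:R * t ^+ 2 / (32 * B ^+ 2))) =
    expR (M%:R * ((2 * c * (2 * B)) ^+ 2 / 2)) * expR (- (c * (M%:R * t))).
  by rewrite -expRD; congr expR; rewrite /c; field; rewrite gt_eqF.
rewrite mulrA; apply: le_trans (ler_wpM2r (expR_ge0 _) mgf).
rewrite mulr_suml big_mkcond; apply: ler_sum => s _.
rewrite -mulrA -expRD -mulrBr; case: ifP => [tail|_].
  rewrite -[leLHS]mulr1 ler_wpM2l ?iid_ge0 // -[leLHS]expR0 ler_expR.
  apply: mulr_ge0 => //; rewrite subr_ge0; exact: tail.
by rewrite mulr_ge0 ?iid_ge0 ?expR_ge0.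
Qed.

Lemma emp_loss_min (R : realType) (n M : nat) (nu : {set 'I_n}) (u : 'I_n)
    (s : {ffun 'I_M -> cfg n}) (B : R) (w w' : feat_idx nu -> R) :
  (0 < M)%N -> is_constrained_min u s B w -> norm1 w' <= B ->
  \sum_k excess_loss u w w' (s k) <= 0.
Proof.
move=> M0 [_ wmin] /wmin.
by rewrite /emp_loss ler_pM2l ?invr_gt0 ?ltr0n // -subr_le0 -sumrB.
Qed.

(** * Constants and union bound *)

(** Here [z] stands for [zeta * D ^ d]; squaring and using [1 + expR (2 * gam) >= 2] gives
    [2 * z^2 <= eps]. *)
Lemma truncation_le (R : realType) (z gam eps : R) :
  0 <= z -> 0 <= gam -> 0 <= eps ->
  z * Num.sqrt (1 + expR (2 * gam)) <= Num.sqrt eps -> (2 * z) ^+ 2 <= 2 * eps.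
Proof.
move=> z0 gam0 eps0 hz.
have e1 : 1 <= expR (2 * gam) by rewrite -[leLHS]expR0 ler_expR mulr_ge0.
have : (z * Num.sqrt (1 + expR (2 * gam))) ^+ 2 <= Num.sqrt eps ^+ 2.
  by rewrite lerXn2r ?nnegrE ?sqrtr_ge0 // mulr_ge0 ?sqrtr_ge0.
rewrite exprMn !sqr_sqrtr //; last by lra.
have := ler_wpM2l (sqr_ge0 z) e1; lra.
Qed.

(** With [t = eps / 2] and [B = 2 * gam] the Chernoff exponent is [M * eps^2 / (512 * gam^2)], which
    explains [512]. It is at least the logarithm, so the left side is at most a quarter of
    [delta / n]. *)
Lemma tail_le (R : realType) (n D k M : nat) (gam eps delta : R) :
  (0 < n)%N -> 0 < gam -> 0 < eps -> 0 < delta -> (k <= D)%N ->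
  512 * gam ^+ 2 * ln (8 * n%:R * 2 ^+ D / delta) / eps ^+ 2 <= M%:R ->
  2 * 2 ^+ k * expR (- (M%:R * (eps / 2) ^+ 2 / (32 * (2 * gam) ^+ 2)))
  <= delta / n%:R.
Proof.
move=> n0 gam0 eps0 delta0 kD hM.
have nR : 0 < n%:R :> R by rewrite ltr0n.
have D0 : 0 < 2 ^+ D :> R by rewrite exprn_gt0.
have arg0 : 0 < 8 * n%:R * 2 ^+ D / delta by rewrite !(mulr_gt0, invr_gt0).
have expo : expR (- (M%:R * (eps / 2) ^+ 2 / (32 * (2 * gam) ^+ 2))) <=
    (8 * n%:R * 2 ^+ D / delta)^-1.
  rewrite -[X in _ <= X^-1](lnK (x := _)) ?posrE // -expRN ler_expR lerN2.
  rewrite ler_pdivrMr ?exprn_gt0 // in hM.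
  rewrite ler_pdivlMr; last by rewrite !(mulr_gt0, exprn_gt0).
  lra.
have pow : 2 ^+ k <= 2 ^+ D :> R by rewrite ler_eXn2l // ltr1n.
apply: (@le_trans _ _ (2 * 2 ^+ D * (8 * n%:R * 2 ^+ D / delta)^-1)).
  by apply: ler_pM; rewrite ?mulr_ge0 ?expR_ge0 ?exprn_ge0 // ler_pM2l.
have -> : 2 * 2 ^+ D * (8 * n%:R * 2 ^+ D / delta)^-1 = delta / n%:R / 4.
  by field; rewrite !gt_eqF.
have : 0 <= delta / n%:R by rewrite divr_ge0 ?ltW.
lra.
Qed.

(** Union bound: a sample violating some [E u] is counted in at least one of the failure sums. *)
Lemma iid_prob_ge (R : realType) (n m : nat) (J : 'M[R]_(n, m))
    (h : 'I_n -> R) (g : 'I_m -> R) (M : nat) (K : finType)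
    (E : K -> pred {ffun 'I_M -> cfg n}) (b : R) :
  (forall u, \sum_(s | ~~ E u s) iid (marg_pmf J h g) s <= b) ->
  1 - #|K|%:R * b <= iid_prob J h g (fun s => forall u, E u s).
Proof.
move=> Eb; pose W := iid (marg_pmf J h g) (M := M).
have W0 s : 0 <= W s by apply: iid_ge0 => x; exact: marg_pmf_ge0.
suff bad : \sum_(s | ~~ `[< forall u, E u s >]) W s <= #|K|%:R * b.
  have := sum_iid1 M (sum_marg_pmf J h g).
  rewrite (bigID (fun s => `[< forall u, E u s >])) /= => total.
  by rewrite lerBlDr -[leLHS]total lerD2l.
apply: (@le_trans _ _ (\sum_u \sum_(s | ~~ E u s) W s)); last first.
  apply: (le_trans (ler_sum _ (fun u _ => Eb u))).
  by rewrite sumr_const mulr_natl.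
under [leRHS]eq_bigr do rewrite big_mkcond.
rewrite exchange_big /= big_mkcond.
apply: ler_sum => s _.
have term_ge0 u : 0 <= (if ~~ E u s then W s else 0) by case: ifP.
case: asboolP => [_|nE] /=; first exact: sumr_ge0.
have [u nEu] : exists u, ~~ E u s.
  apply: contrapT => /forallNP Eall; apply: nE => u.
  by apply/negPn/negP; exact: Eall.
rewrite (bigD1 u) //= nEu lerDl; exact: sumr_ge0.
Qed.

Theorem theorem6 (R : realType) :
  exists C : R, 0 < C /\
  forall (n m : nat) (J : 'M[R]_(n, m)) (h : 'I_n -> R) (g : 'I_m -> R)
    (delta eps zeta : R) (nbr : 'I_n -> {set 'I_n}) (M : nat)
    (west : forall (s : {ffun 'I_M -> cfg n}) (u : 'I_n), feat_idx (nbr u) -> R),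
  0 < delta -> 0 < eps -> 0 < zeta ->
  (forall u, nbr u \subset mrf_nbhd J h g u) ->
  (forall u i (T : {set 'I_n}), i != u -> u \in T -> i \in T ->
     zeta <= `|fhat J h g T| -> i \in nbr u) ->
  (forall s u, is_constrained_min u s (2 * gammax J h g) (west s u)) ->
  C * gammax J h g ^+ 2
    * ln (8 * n%:R * 2%:R ^+ Dmax J h g / delta) / eps ^+ 2 <= M%:R ->
  zeta * (Dmax J h g)%:R ^+ dmax J * Num.sqrt (1 + expR (2 * gammax J h g))
    <= Num.sqrt eps ->
  1 - delta <=
  iid_prob J h g (fun s => forall u : 'I_n,
                    pred_error J h g u (west s u) <= eps).
Proof.
exists 512; split => // n m J h g delta eps zeta nbr M west.
move=> delta0 eps0 zeta0 nbr_mrf nbr_large west_min hM hzeta.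
have u_nbr u : u \notin nbr u.
  apply/negP => /(subsetP (nbr_mrf u)); by rewrite !inE eqxx.
have gam0 := gammax_ge0 J h g.
set gam := gammax J h g in gam0 hM hzeta west_min *.
pose ws u := wstar J h g (nu := nbr u) u.
have ws_norm u : norm1 (ws u) <= 2 * gam by exact: norm1_wstar.
have error_le s u : pred_error J h g u (west s u) <=
    \sum_x marg_pmf J h g x * excess_loss u (west s u) (ws u) x + eps / 2.
  (* The squared error of the log-odds is at most [2 * eps], and a quarter of it is half the error
     budget. *)
  have -> : eps / 2 = 2 * eps / 4 by field.
  apply: pred_error_le => // x.
  apply: le_trans (truncation_le _ gam0 (ltW eps0) hzeta); last first.
    by rewrite mulr_ge0 ?exprn_ge0 // ltW.
  rewrite -[leLHS]real_normK ?num_real //.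
  have := log_odds_approx x zeta0 (u_nbr u) (nbr_large u).
  by move=> ap; rewrite lerXn2r ?nnegrE // (le_trans _ ap).
pose good u (s : {ffun 'I_M -> cfg n}) := pred_error J h g u (west s u) <= eps.
suff bad_le u : \sum_(s | ~~ good u s) iid (marg_pmf J h g) s <= delta / n%:R.
  apply: le_trans (iid_prob_ge bad_le); rewrite lerD2l lerN2 card_ord.
  have [->|n0] := posnP n; first by rewrite mul0r ltW.
  by rewrite mulrC divfK // pnatr_eq0 -lt0n.
have n0 : (0 < n)%N by apply: leq_trans (ltn_ord u).
have nR : 0 < n%:R :> R by rewrite ltr0n.
(* The tail bound requires a positive radius. For [gam = 0] the l1-ball is the origin, every [wdot]
   vanishes, and so does the excess loss. *)
have [gamE|gam_neq0] := eqVneq gam 0.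
  rewrite big1 ?divr_ge0 ?ltW // => s; rewrite -ltNge ltNge => /negP[].
  have zero (w : feat_idx (nbr u) -> R) x : norm1 w <= 2 * gam -> wdot w x = 0.
    rewrite gamE mulr0 => w0; apply/eqP; rewrite -normr_le0.
    exact: le_trans (norm_wdot_le w x) w0.
  apply: (le_trans (error_le s u)); rewrite big1 ?add0r.
    by rewrite ler_pdivrMr // ler_peMr ?ler1n // ltW.
  move=> x _; rewrite /excess_loss !zero ?subrr ?mulr0 //.
  by case: (west_min s u).
have {gam_neq0}gam_gt0 : 0 < gam by rewrite lt_neqAle eq_sym gam_neq0.
(* If [delta >= n] the bound on a probability is trivial; otherwise the logarithm in the sample size
   is positive, which forces [M > 0]. *)
have [delta1|delta1] := leP 1 (delta / n%:R).
  apply: le_trans delta1; rewrite -(sum_iid1 M (sum_marg_pmf J h g)).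
  rewrite big_mkcond; apply: ler_sum => s _; case: ifP => // _.
  by apply: iid_ge0 => x; exact: marg_pmf_ge0.
have M0 : (0 < M)%N.
  rewrite -(ltr0n R); apply: lt_le_trans hM.
  rewrite !(mulr_gt0, exprn_gt0, invr_gt0) // ln_gt0 //.
  rewrite ltr_pdivlMr // mul1r.
  rewrite ltr_pdivrMr // mul1r in delta1.
  apply: (lt_le_trans delta1).
  have D1 : 1 <= 2 ^+ Dmax J h g :> R by rewrite exprn_ege1 // ler1n.
  apply: (@le_trans _ _ (8 * n%:R)); first by rewrite ler_peMl ?ler1n // ltW.
  by rewrite ler_peMr // mulr_ge0 ?ltW.
have card_nbr : (#|nbr u| <= Dmax J h g)%N.
  exact: leq_trans (subset_leq_card (nbr_mrf u)) (leq_bigmax u).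
apply: le_trans (tail_le n0 gam_gt0 eps0 delta0 card_nbr hM).
have west_norm s : norm1 (west s u) <= 2 * gam by case: (west_min s u).
have B0 : 0 < 2 * gam by rewrite mulr_gt0.
have t0 : 0 <= eps / 2 by rewrite divr_ge0 ?ltW.
apply: le_trans (regression_tail u (@marg_pmf_ge0 _ _ _ J h g)
  (sum_marg_pmf J h g) B0 t0 west_norm (ws_norm u)).
rewrite big_mkcond [leRHS]big_mkcond; apply: ler_sum => s _.
have W0 : 0 <= iid (marg_pmf J h g) s.
  by apply: iid_ge0 => x; exact: marg_pmf_ge0.
(* On failure the population excess loss is at least [eps / 2] while the empirical one is at most
   [0]: this is the deviation controlled by [regression_tail]. *)
case: ifP => [|_]; last by case: ifP.
rewrite -ltNge => bad; rewrite ifT //.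
have emp := emp_loss_min M0 (west_min s u) (ws_norm u).
have pop : eps / 2 <=
    \sum_x marg_pmf J h g x * excess_loss u (west s u) (ws u) x.
  rewrite -(lerD2r (eps / 2)) -splitr.
  exact: ltW (lt_le_trans bad (error_le s u)).
apply: (le_trans (ler_wpM2l (ler0n R M) pop)).
by rewrite lerBrDr gerDl.
Qed.
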